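(* Consider the scalar quadratic Gaussian signaling game with source $m\sim\mathcal{N}(0,\mathbb{E}[m^2])$, channel noise $w\sim\mathcal{N}(0,\mathbb{E}[w^2])$ independent of $m$ (both variances positive), encoder cost $(m-u-b)^2+\lambda x^2$ and decoder cost $(m-u)^2$, with $b\in\mathbb{R}$, $\lambda>0$; the information theoretic lower bounds on the costs are defined in the context. (1) For the game setup, if $\lambda\ge\mathbb{E}[m^2]/\mathbb{E}[w^2]$ (non-informative equilibria), the information theoretic lower bounds on the costs are achievable. (2) For the game setup, if $\lambda<\mathbb{E}[m^2]/\mathbb{E}[w^2]$ and $b=0$, then the information theoretic lower bounds on the costs are achievable by linear policies. (3) For the game setup, if $\lambda<\mathbb{E}[m^2]/\mathbb{E}[w^2]$ and $b\neq0$, the information theoretic lower bounds on the costs are not achievable by affine policies. (4) For the team setup, the information theoretic lower bounds on the costs are always (both in the informative and non-informative cases) achievable by affine policies.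
   Context: The encoder observes $m$ and sends a real-valued $x=\gamma^e(m)$; the decoder receives $y=x+w$ and chooses $u=\gamma^d(y)\in\mathbb{R}$; policies are measurable functions. $J^e=\mathbb{E}[(m-u-b)^2+\lambda x^2]$, $J^d=\mathbb{E}[(m-u)^2]$, $J^g=J^e+J^d$ (evaluated at a Nash equilibrium), and the team cost is $J^t=J^e+J^d$ (minimized jointly over $\gamma^e,\gamma^d$). A pair $(\gamma^{*,e},\gamma^{*,d})$ is a Nash equilibrium if $J^e(\gamma^{*,e},\gamma^{*,d})\le J^e(\gamma^e,\gamma^{*,d})$ for all $\gamma^e$ and $J^d(\gamma^{*,e},\gamma^{*,d})\le J^d(\gamma^{*,e},\gamma^d)$ for all $\gamma^d$. Policies are affine if $\gamma^e(m)=Am+C$, $\gamma^d(y)=Ky+L$, and linear if moreover $C=L=0$. Information theoretic lower bounds. Game setup: with $P=\mathbb{E}[x^2]$, one has $J^e\ge b^2+\lambda P+\frac{\mathbb{E}[m^2]}{1+P/\mathbb{E}[w^2]}$ and $J^d\ge \frac{\mathbb{E}[m^2]}{1+P/\mathbb{E}[w^2]}$ in equilibrium; the lower bounds are the values of these right-hand sides at the $P\ge0$ minimizing the bound on $J^e$, and their sum for $J^g$. Explicitly: - if $\lambda<\mathbb{E}[m^2]/\mathbb{E}[w^2]$: $2\sqrt{\lambda\mathbb{E}[m^2]\mathbb{E}[w^2]}+b^2-\lambda\mathbb{E}[w^2]$ for $J^e$, $\sqrt{\lambda\mathbb{E}[m^2]\mathbb{E}[w^2]}$ for $J^d$, and $3\sqrt{\lambda\mathbb{E}[m^2]\mathbb{E}[w^2]}+b^2-\lambda\mathbb{E}[w^2]$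 for $J^g$; - if $\lambda\ge\mathbb{E}[m^2]/\mathbb{E}[w^2]$: $\mathbb{E}[m^2]+b^2$ for $J^e$, $\mathbb{E}[m^2]$ for $J^d$, and $2\mathbb{E}[m^2]+b^2$ for $J^g$. Team setup: the lower bound is $\min_{P\ge0}\big(\frac{b^2}{2}+\lambda P+\frac{2\mathbb{E}[m^2]}{1+P/\mathbb{E}[w^2]}\big)$, which equals $2\sqrt{2\lambda\mathbb{E}[m^2]\mathbb{E}[w^2]}+\frac{b^2}{2}-\lambda\mathbb{E}[w^2]$ if $\lambda<2\mathbb{E}[m^2]/\mathbb{E}[w^2]$ (informative case), and $2\mathbb{E}[m^2]+\frac{b^2}{2}$ if $\lambda\ge2\mathbb{E}[m^2]/\mathbb{E}[w^2]$ (non-informative case). In the game setup, the lower bounds are achievable (by policies of a given class) if there is a Nash equilibrium (with policies in that class) at which $(J^e,J^d,J^g)$ equals the triple of lower bounds. In the team setup, the bound is achievable by affine policies if some pair of affine policies attains it as the value of $J^e+J^d$. *)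

(* Defs.v *)
From HB Require Import structures.
From mathcomp Require Import all_boot all_order all_algebra.
From mathcomp Require Import all_classical all_reals all_analysis.
From mathcomp Require Import ring lra.

Set Implicit Arguments.
Unset Strict Implicit.
Unset Printing Implicit Defensive.

Import Order.TTheory GRing.Theory Num.Theory.

Local Open Scope classical_set_scope.
Local Open Scope ring_scope.

(* [normal_prob] takes the standard deviation, hence the square root. Laws are
   compared on measurable sets only, where [distribution] and [normal_prob]
   are meaningful. *)
Definition centered_gaussian (d : measure_display) (T : measurableType d)
    (R : realType) (P : probability T R) (X : {RV P >-> R}) (v : R) : Prop :=
  forall A : set R, measurable A ->
    distribution P X A = normal_prob 0 (Num.sqrt v) A.

Definition independent_RV (d : measure_display) (T : measurableType d)
    (R : realType) (P : probability T R) (X Y : {RV P >-> R}) : Prop :=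
  forall A B : set R, measurable A -> measurable B ->
    P ((X @^-1` A) `&` (Y @^-1` B)) = (P (X @^-1` A) * P (Y @^-1` B))%E.

Section policies.
Context {R : realType}.

Definition policy := {mfun R >-> R}.

Definition affine_policy (g : policy) : Prop :=
  exists A C : R, forall z, g z = A * z + C.

Definition linear_policy (g : policy) : Prop :=
  exists A : R, forall z, g z = A * z.

Definition any_policy (g : policy) : Prop := True.

End policies.

Arguments policy : clear implicits.

(* Costs are expectations of nonnegative functions, with values in \bar R: a
   policy pair with an infinite second moment has cost +oo. *)
Section costs.
Context {d : measure_display} {T : measurableType d} {R : realType}
  (P : probability T R) (m w : {RV P >-> R}) (b lambda : R).
Implicit Types ge gd : policy R.

Definition action ge gd (t : T) : R := gd (ge (m t) + w t).

Definition enc_cost ge gd : \bar R :=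
  'E_P[fun t => (m t - action ge gd t - b) ^+ 2 + lambda * ge (m t) ^+ 2].

Definition dec_cost ge gd : \bar R :=
  'E_P[fun t => (m t - action ge gd t) ^+ 2].

Definition total_cost ge gd : \bar R := (enc_cost ge gd + dec_cost ge gd)%E.

Definition nash ge gd : Prop :=
  (forall ge', (enc_cost ge gd <= enc_cost ge' gd)%E) /\
  (forall gd', (dec_cost ge gd <= dec_cost ge gd')%E).

End costs.

Section lower_bounds.
Context {R : realType}.
Implicit Types (f : R -> R) (p b lambda vm vw : R).

Definition is_argmin_ge0 f p : Prop :=
  0 <= p /\ forall q, 0 <= q -> f p <= f q.

(* Default value 0 when there is no minimizer; for the bounds below the
   minimizer exists and is unique, see [argmin_ge0_lt] and [argmin_ge0_ge]. *)
Definition argmin_ge0 f : R := xget 0 [set p | is_argmin_ge0 f p].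

Definition enc_rhs b lambda vm vw p : R :=
  b ^+ 2 + lambda * p + vm / (1 + p / vw).

Definition dec_rhs vm vw p : R := vm / (1 + p / vw).

Definition team_rhs b lambda vm vw p : R :=
  b ^+ 2 / 2 + lambda * p + 2 * vm / (1 + p / vw).

(* In the game, the power is the one minimizing the bound on the encoder cost,
   also for the bound on the decoder cost. *)
Definition game_power b lambda vm vw : R := argmin_ge0 (enc_rhs b lambda vm vw).

Definition enc_lb b lambda vm vw : R :=
  enc_rhs b lambda vm vw (game_power b lambda vm vw).

Definition dec_lb b lambda vm vw : R :=
  dec_rhs vm vw (game_power b lambda vm vw).

Definition game_lb b lambda vm vw : R :=
  enc_lb b lambda vm vw + dec_lb b lambda vm vw.

Definition team_lb b lambda vm vw : R :=
  team_rhs b lambda vm vw (argmin_ge0 (team_rhs b lambda vm vw)).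

End lower_bounds.

Section achievability.
Context {d : measure_display} {T : measurableType d} {R : realType}
  (P : probability T R) (m w : {RV P >-> R}) (b lambda vm vw : R).

Definition game_achievable (cls : policy R -> Prop) : Prop :=
  exists ge gd : policy R,
    [/\ cls ge, cls gd, nash m w b lambda ge gd &
      [/\ enc_cost m w b lambda ge gd = (enc_lb b lambda vm vw)%:E,
          dec_cost m w ge gd = (dec_lb b lambda vm vw)%:E &
          total_cost m w b lambda ge gd = (game_lb b lambda vm vw)%:E]].

Definition team_achievable (cls : policy R -> Prop) : Prop :=
  exists ge gd : policy R,
    [/\ cls ge, cls gd &
      total_cost m w b lambda ge gd = (team_lb b lambda vm vw)%:E].

End achievability.

Section closed_forms.
Context {R : realType}.
Implicit Types (b c lambda a v vm vw : R).

Lemma argmin_ge0_unique (f : R -> R) (p : R) : 0 <= p ->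
  (forall q, 0 <= q -> q != p -> f p < f q) -> argmin_ge0 f = p.
Proof.
move=> p0 fp; rewrite /argmin_ge0; case: xgetP => [q _ [q0 qm]|/(_ p) []].
  apply/eqP/negPn/negP => /(fp _ q0).
  by rewrite ltNge (qm _ p0).
split=> // q q0; have [->//|qp] := eqVneq q p.
exact/ltW/fp.
Qed.

Lemma argmin_ge0_ge c lambda a v : 0 < a -> 0 < v -> a / v <= lambda ->
  argmin_ge0 (fun p => c + lambda * p + a / (1 + p / v)) = 0.
Proof.
move=> a0 v0; rewrite ler_pdivrMr// => la.
apply: argmin_ge0_unique => // q q0 qn0.
have {}q0 : 0 < q by rewrite lt_neqAle eq_sym qn0.
have vq : 0 < v + q by apply: addr_gt0.
rewrite -subr_gt0.
suff -> : c + lambda * q + a / (1 + q / v) - (c + lambda * 0 + a / (1 + 0 / v))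
  = q * ((lambda * v - a) + lambda * q) / (v + q).
  rewrite divr_gt0// mulr_gt0// ltr_wpDl ?subr_ge0// mulr_gt0//.
  by rewrite -(pmulr_lgt0 _ v0) (lt_le_trans a0).
field.
by rewrite !gt_eqF.
Qed.

Lemma argmin_ge0_lt c lambda a v :
    0 < lambda -> 0 < a -> 0 < v -> lambda < a / v ->
  argmin_ge0 (fun p => c + lambda * p + a / (1 + p / v)) =
  Num.sqrt (lambda * a * v) / lambda - v.
Proof.
move=> l0 a0 v0; rewrite ltr_pdivlMr// => la.
set s := Num.sqrt _.
have s0 : 0 < s by rewrite sqrtr_gt0 !mulr_gt0.
have s2 : s ^+ 2 = lambda * a * v by rewrite sqr_sqrtr// !mulr_ge0// ltW.
have aE : a = s ^+ 2 / (lambda * v) by rewrite s2; field; rewrite !gt_eqF.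
have ls : lambda * v < s.
  rewrite -ltr_sqr ?nnegrE ?mulr_ge0 ?ltW// s2 expr2.
  by rewrite (mulrAC lambda a) ltr_pM2l ?mulr_gt0.
apply: argmin_ge0_unique => [|q q0 qs].
  by rewrite subr_ge0 ler_pdivlMr// mulrC ltW.
have vq : 0 < v + q by rewrite ltr_pwDl.
rewrite -subr_gt0 aE.
suff -> : c + lambda * q + s ^+ 2 / (lambda * v) / (1 + q / v) -
    (c + lambda * (s / lambda - v) +
     s ^+ 2 / (lambda * v) / (1 + (s / lambda - v) / v))
  = (lambda * (v + q) - s) ^+ 2 / (lambda * (v + q)).
  apply: divr_gt0; last exact: mulr_gt0.
  rewrite exprn_even_gt0//= subr_eq0.
  apply: contra_neq qs => <-; field; rewrite ?gt_eqF//.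
field.
by rewrite !gt_eqF//= ; lra.
Qed.

Lemma game_lb_ge b lambda vm vw : 0 < vm -> 0 < vw -> vm / vw <= lambda ->
  [/\ enc_lb b lambda vm vw = vm + b ^+ 2,
      dec_lb b lambda vm vw = vm &
      game_lb b lambda vm vw = 2 * vm + b ^+ 2].
Proof.
move=> vm0 vw0 vl; rewrite /game_lb /enc_lb /dec_lb /game_power.
rewrite [argmin_ge0 _]argmin_ge0_ge// /enc_rhs /dec_rhs.
by split; field; rewrite gt_eqF.
Qed.

Lemma game_lb_lt b lambda vm vw :
    0 < lambda -> 0 < vm -> 0 < vw -> lambda < vm / vw ->
  let s := Num.sqrt (lambda * vm * vw) in
  [/\ enc_lb b lambda vm vw = 2 * s + b ^+ 2 - lambda * vw,
      dec_lb b lambda vm vw = s &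
      game_lb b lambda vm vw = 3 * s + b ^+ 2 - lambda * vw].
Proof.
move=> l0 vm0 vw0 lv s; rewrite /game_lb /enc_lb /dec_lb /game_power.
rewrite [argmin_ge0 _]argmin_ge0_lt// /enc_rhs /dec_rhs -/s.
have s0 : 0 < s by rewrite sqrtr_gt0 !mulr_gt0.
have s2 : s ^+ 2 = lambda * vm * vw by rewrite sqr_sqrtr// !mulr_ge0// ltW.
have -> : vm = s ^+ 2 / (lambda * vw) by rewrite s2; field; rewrite !gt_eqF.
by split; field; rewrite !gt_eqF//=; lra.
Qed.

Lemma team_lb_ge b lambda vm vw : 0 < vm -> 0 < vw -> 2 * vm / vw <= lambda ->
  team_lb b lambda vm vw = 2 * vm + b ^+ 2 / 2.
Proof.
move=> vm0 vw0 vl; rewrite /team_lb.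
rewrite [argmin_ge0 _]argmin_ge0_ge ?mulr_gt0// /team_rhs.
by field; rewrite gt_eqF.
Qed.

Lemma team_lb_lt b lambda vm vw :
    0 < lambda -> 0 < vm -> 0 < vw -> lambda < 2 * vm / vw ->
  team_lb b lambda vm vw =
  2 * Num.sqrt (2 * lambda * vm * vw) + b ^+ 2 / 2 - lambda * vw.
Proof.
move=> l0 vm0 vw0 lv; rewrite /team_lb.
rewrite [argmin_ge0 _]argmin_ge0_lt ?mulr_gt0// /team_rhs.
have -> : lambda * (2 * vm) * vw = 2 * lambda * vm * vw by ring.
set s := Num.sqrt _.
have s0 : 0 < s by rewrite sqrtr_gt0 !mulr_gt0.
have s2 : s ^+ 2 = 2 * lambda * vm * vw by rewrite sqr_sqrtr// !mulr_ge0// ltW.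
have -> : vm = s ^+ 2 / (2 * lambda * vw) by rewrite s2; field; rewrite !gt_eqF.
by field; rewrite !gt_eqF//=; lra.
Qed.

End closed_forms.

(* Main.v *)
Require Import Defs.
From HB Require Import structures.
From mathcomp Require Import all_boot all_order all_algebra.
From mathcomp Require Import all_classical all_reals all_analysis.
From mathcomp Require Import measurable_realfun.
From mathcomp Require Import ring lra.

Set Implicit Arguments.
Unset Strict Implicit.
Unset Printing Implicit Defensive.

Import Order.TTheory GRing.Theory Num.Theory.

Local Open Scope classical_set_scope.
Local Open Scope ring_scope.

(* Everything rests on one symmetry. For independent centered Gaussians X, Y and
   Z = A X + Y, let K be the regression coefficient of X on Z. The joint law is
   invariant under the reflection that fixes Z and sends X - K Z to its opposite;
   averaging (k X - g(Z))^2 over it gives the Pythagorean identity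
     E (k X - g(Z))^2 = E (k (X - K Z))^2 + E (k K Z - g(Z))^2
   in [0, +oo] for every measurable g, without integrability conditions or
   conditional expectations. It yields the optimality of the linear decoder, and
   for A = 0 the separation of the channel noise from the encoder's cost, which
   then is a pointwise quadratic problem.

   At a linear pair with encoder gain A both costs equal the right-hand sides of
   the bounds at the power A^2 E[m^2], so achievability amounts to choosing A with
   the optimal power and checking the encoder's first-order condition. At an
   affine equilibrium with these costs, decoder optimality forces the mean error
   to vanish and the encoder cost forces C = L = 0; the encoder then gains by
   shifting x by a multiple of K b, and K = 0 would mean zero power. *)

(** * Reflections of Lebesgue measure, and Gaussian integrals through their density *)

Section lebesgue_reflection.
Context {R : realType}.
Local Notation mu := (@lebesgue_measure R).

Lemma measurable_subl (c : R) : measurable_fun [set: R] (fun x : R => c - x).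
Proof. exact: measurable_funB. Qed.

(** By uniqueness, half-open intervals suffice: the reflection only swaps which endpoint is
    included, and the length is unchanged. *)
Lemma lebesgue_measure_reflect (c : R) (A : set R) : measurable A ->
  pushforward mu (fun x : measurableTypeR R => (c - x : measurableTypeR R)) A
  = mu A.
Proof.
move=> mA.
have mc : measurable_fun setT
    (fun x : measurableTypeR R => (c - x : measurableTypeR R)).
  exact: measurable_subl.
pose f : {mfun measurableTypeR R >-> measurableTypeR R} :=
  HB.pack (fun x : measurableTypeR R => (c - x : measurableTypeR R))
    (isMeasurableFun.Build _ _ _ _ _ mc).
apply/esym.
apply: (@lebesgue_measure_unique R (pushforward mu f)) => //= _ [[a b]] _ <-.
rewrite /pushforward.
have -> : f @^-1` `]a, b] = `[(c - b), (c - a)[%classic.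
  by apply/seteqP; split => x /=; rewrite !in_itv/= => /andP[? ?]; apply/andP; lra.
rewrite /= !lebesgue_measure_itv/= !lte_fin ltrD2l ltrN2.
by case: ifPn => // _; congr EFin; ring.
Qed.

Lemma ge0_integral_reflect (c : R) (f : R -> \bar R) :
  measurable_fun setT f -> (forall x, 0 <= f x)%E ->
  (\int[mu]_x f (c - x)%R = \int[mu]_x f x)%E.
Proof.
move=> mf f0.
have mc : measurable_fun setT
    (fun x : measurableTypeR R => (c - x : measurableTypeR R)).
  exact: measurable_subl.
rewrite -[LHS](@ge0_integral_pushforward _ _ _ _ _ _ mc mu setT f)//.
by apply: eq_measure_integral => A mA _; exact: lebesgue_measure_reflect.
Qed.

(** The Radon-Nikodym derivative of [normal_prob] and [normal_pdf] have the same integral over every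
    measurable set, so they agree almost everywhere. *)
Lemma ge0_integral_normal_prob (c s : R) (f : R -> \bar R) :
  measurable_fun setT f -> (forall x, 0 <= f x)%E ->
  (\int[normal_prob c s]_x f x = \int[mu]_x (f x * (normal_pdf c s x)%:E))%E.
Proof.
move=> mf f0; have dom := normal_prob_dominates c s.
rewrite -(Radon_Nikodym_SigmaFinite.change_of_variables dom)//.
have mpdf := measurable_int mu (integrable_normal_pdf c s).
have iRN := Radon_Nikodym_SigmaFinite.f_integrable dom.
apply: ae_eq_integral => //.
- by apply: emeasurable_funM => //; exact: measurable_int iRN.
- exact: emeasurable_funM.
- apply: ae_eqe_mul2l; apply: integral_ae_eq => //.
  by move=> A _ mA; rewrite -Radon_Nikodym_SigmaFinite.f_integral.
Qed.

End lebesgue_reflection.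

(** * Joint law of two independent Gaussians and its reflection symmetry *)

Section gaussian_pair.
Context {d : measure_display} {T : measurableType d} {R : realType}
  {P : probability T R}.
Local Notation mu := (@lebesgue_measure R).
Local Notation pdf v := (normal_pdf 0 (Num.sqrt v)).
Implicit Types (X Y : {RV P >-> R}) (h : R * R -> R).

(* [normal_prob] lives on [measurableTypeR R], whose display differs from the
   default one on [R]: random variables are retyped to transport integrals. *)
Lemma expectation_gaussian X (v : R) (f : R -> R) :
    centered_gaussian X v -> measurable_fun setT f -> (forall x, 0 <= f x) ->
  ('E_P[f \o X] = \int[mu]_x (f x * pdf v x)%:E)%E.
Proof.
move=> XN mf f0.
have mEf : measurable_fun setT (EFin \o f).
  exact/measurable_EFinP.
have Ef0 x : (0 <= (EFin \o f) x)%E by rewrite lee_fin.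
have mX : measurable_fun setT (X : T -> measurableTypeR R).
  exact: measurable_funPT X.
pose X' : {mfun T >-> measurableTypeR R} :=
  HB.pack (X : T -> measurableTypeR R) (isMeasurableFun.Build _ _ _ _ _ mX).
transitivity (\int[distribution P X']_x (EFin \o f) x)%E.
  by rewrite unlock ge0_integral_distribution.
transitivity (\int[normal_prob 0 (Num.sqrt v)]_x (EFin \o f) x)%E.
  by apply: eq_measure_integral => A mA _; exact: XN.
exact: ge0_integral_normal_prob.
Qed.

(** Independence identifies the joint law with the product measure on rectangles, hence everywhere;
    Tonelli and the two densities do the rest. *)
Lemma expectation_gaussian_pair X Y (vx vy : R) h :
    centered_gaussian X vx -> centered_gaussian Y vy -> independent_RV X Y ->
    measurable_fun setT h -> (forall z, 0 <= h z) ->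
  ('E_P[fun t => h (X t, Y t)] =
    \int[mu]_x \int[mu]_y (h (x, y) * (pdf vx x * pdf vy y))%:E)%E.
Proof.
move=> XN YN XY mh h0.
have mp : measurable_fun setT
    (fun t => (X t, Y t) : measurableTypeR R * measurableTypeR R).
  by apply: measurable_fun_pair;
    [exact: measurable_funPT X|exact: measurable_funPT Y].
pose XY2 : {mfun T >-> (measurableTypeR R * measurableTypeR R)%type} :=
  HB.pack (fun t => (X t, Y t) : measurableTypeR R * measurableTypeR R)
    (isMeasurableFun.Build _ _ _ _ _ mp).
have mEh : measurable_fun setT
    (EFin \o h : measurableTypeR R * measurableTypeR R -> \bar R).
  exact/measurable_EFinP.
have Eh0 z : (0 <= (EFin \o h) z)%E by rewrite lee_fin.
transitivity (\int[distribution P XY2]_z (EFin \o h) z)%E.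
  by rewrite unlock ge0_integral_distribution.
transitivity (\int[normal_prob 0 (Num.sqrt vx) \x normal_prob 0 (Num.sqrt vy)]_z
    (EFin \o h) z)%E.
  apply/esym/eq_measure_integral => A mA _.
  apply: (product_measure_unique (m' := distribution P XY2)) => // B C mB mC.
  transitivity (P (X @^-1` B) * P (Y @^-1` C))%E; first exact: XY.
  by congr (_ * _)%E; [exact: XN|exact: YN].
rewrite fubini_tonelli1//= ge0_integral_normal_prob; last 2 first.
  exact: measurable_fun_fubini_tonelli_F.
  by move=> x; apply: integral_ge0 => y _.
apply: eq_integral => x _.
have mhx : measurable_fun setT (EFin \o (fun y => h (x, y))).
  exact/measurable_EFinP/measurableT_comp.
rewrite /fubini_F ge0_integral_normal_prob//.
rewrite -ge0_integralZr//.
- by apply: eq_integral => y _; rewrite -!EFinM; congr EFin; ring.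
- apply: emeasurable_funM => //.
  exact: (measurable_int mu (integrable_normal_pdf _ _)).
- by move=> y _; rewrite -EFinM lee_fin mulr_ge0// normal_pdf_ge0.
- by rewrite lee_fin normal_pdf_ge0.
Qed.

Lemma normal_pdf_sqrt (v x : R) : 0 < v ->
  pdf v x = normal_peak (Num.sqrt v) * expR (- x ^+ 2 / (2 * v)).
Proof.
move=> v0; rewrite normal_pdfE ?gt_eqF ?sqrtr_gt0// /normal_fun subr0.
by rewrite sqr_sqrtr ?ltW// mulr_natl.
Qed.

(** For fixed y the exponent, through x^2 / vx + (y - A x)^2 / vy, is a quadratic in x with vertex
    at K y, so it is symmetric under x -> 2 K y - x. *)
Lemma normal_pdf_reflection (vx vy A K x y : R) :
    0 < vx -> 0 < vy -> K * (A ^+ 2 * vx + vy) = A * vx ->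
  pdf vx x * pdf vy (y - A * x) =
  pdf vx (2 * K * y - x) * pdf vy (y - A * (2 * K * y - x)).
Proof.
move=> vx0 vy0 KE; rewrite !normal_pdf_sqrt//.
rewrite mulrACA [RHS]mulrACA -!expRD; congr (_ * expR _).
have v0 : A ^+ 2 * vx + vy != 0.
  by rewrite gt_eqF// ltr_wpDl// mulr_ge0 ?sqr_ge0// ltW.
have -> : K = A * vx / (A ^+ 2 * vx + vy) by rewrite -KE mulfK.
by field; rewrite v0 !gt_eqF.
Qed.

(* The linear map fixing Z = A X + Y and reversing X - K Z is an orthogonal
   reflection for the covariance form of (X, Y). *)
Lemma gaussian_reflection X Y (vx vy A K : R) h :
    0 < vx -> 0 < vy -> K * (A ^+ 2 * vx + vy) = A * vx ->
    centered_gaussian X vx -> centered_gaussian Y vy -> independent_RV X Y ->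
    measurable_fun setT h -> (forall z, 0 <= h z) ->
  ('E_P[fun t => h (X t, A * X t + Y t)%R] =
  'E_P[fun t => h (2 * K * (A * X t + Y t) - X t, A * X t + Y t)%R])%E.
Proof.
move=> vx0 vy0 KE XN YN XY mh h0.
have mlin a b : measurable_fun setT (fun z : R * R => a * z.1 + b * z.2).
  by apply: measurable_funD; apply: measurable_funM.
have mp1 := measurable_normal_pdf (0 : R) (Num.sqrt vx).
have mp2 := measurable_normal_pdf (0 : R) (Num.sqrt vy).
have p1 := normal_pdf_ge0 (0 : R) (Num.sqrt vx).
have p2 := normal_pdf_ge0 (0 : R) (Num.sqrt vy).
pose q x y := pdf vx x * pdf vy (y - A * x).
have mq : measurable_fun setT (fun z : R * R => q z.1 z.2).
  apply: measurable_funM; first exact: measurableT_comp.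
  apply: measurableT_comp => //.
  apply: (eq_measurable_fun (fun z : R * R => - A * z.1 + 1 * z.2)) => //.
  by move=> z _; ring.
have q0 x y : 0 <= q x y by rewrite mulr_ge0.
(* in the coordinates (x, y) = (X, A X + Y) the density is q *)
have EE (g : R * R -> R) : measurable_fun setT g -> (forall z, 0 <= g z) ->
    ('E_P[fun t => g (X t, A * X t + Y t)%R] =
    \int[mu]_y \int[mu]_x (g (x, y) * q x y)%:E)%E.
  move=> mg g0.
  have mg' : measurable_fun setT (fun z : R * R => g (z.1, A * z.1 + 1 * z.2)).
    by apply: measurableT_comp => //; exact: measurable_fun_pair.
  have -> : (fun t => g (X t, A * X t + Y t)) =
      (fun t => (fun z : R * R => g (z.1, A * z.1 + 1 * z.2)) (X t, Y t)).
    by apply/funext => t /=; rewrite mul1r.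
  transitivity (\int[mu]_x \int[mu]_y (g (x, y) * q x y)%:E)%E; last first.
    apply: (fubini_tonelli (fun z : measurableTypeR R * measurableTypeR R =>
      (g z * q z.1 z.2)%:E)) => [|z]; last by rewrite lee_fin mulr_ge0.
    by apply/measurable_EFinP; exact: measurable_funM mg mq.
  etransitivity; first exact: (expectation_gaussian_pair XN YN XY mg').
  apply: eq_integral => x _.
  have mgq : measurable_fun setT (fun y => (g (x, y) * q x y)%:E).
    apply/measurable_EFinP.
    exact: (measurableT_comp (measurable_funM mg mq) (pair1_measurable x)).
  have gq0 y : (0 <= (g (x, y) * q x y)%:E)%E by rewrite lee_fin mulr_ge0.
  (* The translation y -> A x + y is the composite of two reflections, 0 - (- A x - y). *)
  transitivity (\int[mu]_y (g (x, 0 - y) * q x (0 - y))%:E)%E; last first.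
    exact: (ge0_integral_reflect 0 mgq).
  have mgq' : measurable_fun setT (fun y : R => (g (x, 0 - y) * q x (0 - y))%:E).
    exact: (measurableT_comp mgq (measurable_subl 0)).
  transitivity (\int[mu]_y (g (x, 0 - (- (A * x) - y)) *
      q x (0 - (- (A * x) - y)))%:E)%E; last first.
    exact: (ge0_integral_reflect (- (A * x)) mgq').
  apply: eq_integral => y _; rewrite /q.
  have -> : 0 - (- (A * x) - y) = A * x + 1 * (y : R) by ring.
  by have -> : A * x + 1 * y - A * x = y :> R by ring.
have mhr : measurable_fun setT (fun z : R * R => h (2 * K * z.2 - z.1, z.2)).
  apply: measurableT_comp => //; apply: measurable_fun_pair => //.
  apply: (eq_measurable_fun (fun z : R * R => - 1 * z.1 + (2 * K) * z.2)) => //.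
  by move=> z _; ring.
etransitivity; first exact: EE mh h0.
apply/esym; etransitivity; first exact: (EE _ mhr).
apply/esym => /=.
apply: eq_integral => y _.
have mhq : measurable_fun setT (fun x => (h (x, y) * q x y)%:E).
  apply/measurable_EFinP.
  exact: (measurableT_comp (measurable_funM mh mq) (pair2_measurable y)).
transitivity (\int[mu]_x (h (2 * K * y - x, y) * q (2 * K * y - x) y)%:E)%E.
  apply/esym/(ge0_integral_reflect (2 * K * y) mhq) => x.
  by rewrite lee_fin mulr_ge0.
apply: eq_integral => x _; congr (_ * _)%:E.
exact/esym/(normal_pdf_reflection _ _ vx0 vy0 KE).
Qed.

End gaussian_pair.

(** * Variance of the centered Gaussian law *)

Section gaussian_second_moment.
Context {d : measure_display} {T : measurableType d} {R : realType}
  {P : probability T R}.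
Local Notation mu := (@lebesgue_measure R).
Local Notation pdf v := (normal_pdf 0 (Num.sqrt v)).

(** Dividing by t - 1 gives (t + 1) r <= t^2 for t > 1 and the reverse for t < 1; letting t tend to
    1 from both sides forces 2 r = 1. *)
Lemma eq_half_of_cubic_bound (r : R) : 0 <= r ->
  (forall t, 0 < t -> (t ^+ 2 - 1) * r <= t ^+ 2 * (t - 1)) -> r = 1 / 2.
Proof.
move=> r0 H; apply/eqP; rewrite eq_le.
apply/andP; split; rewrite leNgt; apply/negP => rlt.
(* At t = 1 + e the bound reads (2 + e) r <= (1 + e)^2, which fails as r >= 1/2 + 2 e. *)
- have := H (1 + Num.min (1 / 2) ((r - 1 / 2) / 2)).
  have : Num.min (1 / 2) ((r - 1 / 2) / 2) <= 1 / 2 by rewrite ge_min lexx.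
  have : Num.min (1 / 2) ((r - 1 / 2) / 2) <= (r - 1 / 2) / 2.
    by rewrite ge_min lexx orbT.
  have : 0 < Num.min (1 / 2) ((r - 1 / 2) / 2) by rewrite lt_min; apply/andP; lra.
  set e := Num.min _ _ => e0 er e1 /(_ ltac:(lra)).
  rewrite -subr_ge0 (_ : _ - _ = e * ((1 + e) ^+ 2 - (2 + e) * r)); last by ring.
  by rewrite pmulr_rge0// => ?; nra.
(* At t = 1 - e it reads (2 - e) r >= (1 - e)^2, which fails as r = 1/2 - 2 e; here r >= 0 keeps e
   <= 1/4 and t > 0. *)
- have := H (1 - (1 / 2 - r) / 2).
  set e := (1 / 2 - r) / 2 => /(_ ltac:(rewrite /e; lra)).
  have e0 : 0 < e by rewrite /e; lra.
  have re : r = 1 / 2 - 2 * e by rewrite /e; lra.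
  rewrite -subr_ge0 (_ : _ - _ = e * ((2 - e) * r - (1 - e) ^+ 2)); last by ring.
  by rewrite pmulr_rge0// => ?; nra.
Qed.

(* exp z >= 1 + z, applied to the ratio of the two densities *)
Lemma normal_pdf_tangent (v u x : R) : 0 < v -> 0 < u ->
  (1 + (v^-1 - u^-1) / 2 * x ^+ 2) * pdf v x <=
  Num.sqrt u / Num.sqrt v * pdf u x.
Proof.
move=> v0 u0; rewrite !normal_pdf_sqrt//.
have sv : 0 < Num.sqrt v by rewrite sqrtr_gt0.
have su : 0 < Num.sqrt u by rewrite sqrtr_gt0.
have -> : normal_peak (Num.sqrt v) = Num.sqrt u / Num.sqrt v * normal_peak (Num.sqrt u).
  have pE w : 0 < w -> normal_peak (Num.sqrt w) = (Num.sqrt w * Num.sqrt (pi *+ 2))^-1.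
    by move=> w0; rewrite /normal_peak sqr_sqrtr ?ltW// -mulrnAr sqrtrM// ltW.
  have sp : 0 < Num.sqrt (pi *+ 2 : R) by rewrite sqrtr_gt0 mulrn_wgt0// pi_gt0.
  by rewrite !pE//; field; rewrite !gt_eqF.
rewrite mulrCA [leRHS]mulrA ler_pM2l; last first.
  by rewrite mulr_gt0 ?divr_gt0// normal_peak_gt0// gt_eqF.
have -> : - x ^+ 2 / (2 * u) = (v^-1 - u^-1) / 2 * x ^+ 2 + - x ^+ 2 / (2 * v).
  by field; rewrite !gt_eqF.
by rewrite expRD ler_pM2r ?expR_gt0// expR_ge1Dx.
Qed.

(** Integrating the tangent inequality bounds the second moment r against every variance u, with
    equality at u = v. Taking u = t^2 v turns this into the cubic bound for r / (2 v), whose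
    tangency at t = 1 determines r. *)
Lemma integral_sqr_normal_pdf (v : R) : 0 < v ->
  (\int[mu]_x (x ^+ 2 * pdf v x)%:E = v%:E)%E.
Proof.
move=> v0.
have p0 (u x : R) : 0 <= pdf u x by exact: normal_pdf_ge0.
have iN u : mu.-integrable setT (fun x => (pdf u x)%:E) by exact: integrable_normal_pdf.
have mI : measurable_fun setT (fun x : R => (x ^+ 2 * pdf v x)%:E).
  by apply/measurable_EFinP/measurable_funM => //; exact: measurable_normal_pdf.
(* Integrability comes from the tangent inequality at u = 2 v, where the coefficient of x^2 is 1 /
   (4 v). *)
have le_pdf x : x ^+ 2 * pdf v x <=
    4 * v * (Num.sqrt (2 * v) / Num.sqrt v) * pdf (2 * v) x.
  have := @normal_pdf_tangent v (2 * v) x v0 ltac:(lra).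
  rewrite -subr_ge0 -[in X in _ -> X]subr_ge0; set k := _ / Num.sqrt v => le_k.
  have -> : 4 * v * k * pdf (2 * v) x - x ^+ 2 * pdf v x =
      4 * v * (k * pdf (2 * v) x - (1 + (v^-1 - (2 * v)^-1) / 2 * x ^+ 2) * pdf v x)
      + 4 * v * pdf v x by field; rewrite gt_eqF.
  have v40 : 0 <= 4 * v by rewrite mulr_ge0// ltW.
  by rewrite addr_ge0 ?(mulr_ge0 v40 le_k)// mulr_ge0.
have iI : mu.-integrable setT (fun x => (x ^+ 2 * pdf v x)%:E).
  have iZ := integrableZl measurableT (4 * v * (Num.sqrt (2 * v) / Num.sqrt v))
    (iN (2 * v)).
  apply: (le_integrable measurableT _ _ iZ) => [|x _ /=]; first exact: mI.
  rewrite lee_fin ger0_norm; last by rewrite mulr_ge0 ?sqr_ge0.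
  exact: le_trans (le_pdf x) (ler_norm _).
pose r := fine (\int[mu]_x (x ^+ 2 * pdf v x)%:E)%E.
have rE : (\int[mu]_x (x ^+ 2 * pdf v x)%:E = r%:E)%E.
  by rewrite fineK//; exact: integrable_fin_num.
have r0 : 0 <= r.
  by rewrite fine_ge0//; apply: integral_ge0 => x _; rewrite lee_fin mulr_ge0 ?sqr_ge0.
have H u : 0 < u -> 1 + (v^-1 - u^-1) / 2 * r <= Num.sqrt u / Num.sqrt v.
  move=> u0; set c := _ / 2; set k := _ / _.
  have ikN := integrableZl measurableT k (iN u).
  have icI := integrableZl measurableT c iI.
  have : (\int[mu]_x ((pdf v x)%:E + c%:E * (x ^+ 2 * pdf v x)%:E) <=
      \int[mu]_x (k%:E * (pdf u x)%:E))%E.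
    apply: (le_integral measurableT (integrableD measurableT (iN v) icI) ikN).
    move=> x _ /=; rewrite -!EFinM -EFinD lee_fin mulrA.
    by have := normal_pdf_tangent x v0 u0; rewrite mulrDl mul1r.
  rewrite integralD// !integralZl// !integral_normal_pdf rE mule1 -EFinM -EFinD.
  by rewrite lee_fin.
rewrite rE; congr EFin.
have -> : r = 2 * v * (r / (2 * v)) by field; rewrite gt_eqF.
rewrite (@eq_half_of_cubic_bound (r / (2 * v))); first by field.
  by rewrite divr_ge0// mulr_ge0// ltW.
move=> t t0; have := H (t ^+ 2 * v) (mulr_gt0 (exprn_gt0 _ t0) v0).
rewrite sqrtrM ?sqr_ge0// sqrtr_sqr gtr0_norm// mulfK ?gt_eqF ?sqrtr_gt0//.
move=> Ht; rewrite -subr_ge0.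
have -> : t ^+ 2 * (t - 1) - (t ^+ 2 - 1) * (r / (2 * v)) =
  t ^+ 2 * (t - (1 + (v^-1 - (t ^+ 2 * v)^-1) / 2 * r)).
  by field; rewrite !gt_eqF.
by rewrite mulr_ge0 ?sqr_ge0// subr_ge0.
Qed.

Lemma gaussian_second_moment (X : {RV P >-> R}) (v : R) : 0 < v ->
  centered_gaussian X v -> ('E_P[fun t => (X t ^+ 2)%R] = v%:E)%E.
Proof.
move=> v0 XN; rewrite -[RHS]integral_sqr_normal_pdf//.
apply: (expectation_gaussian (f := fun x => x ^+ 2) XN) => // x.
exact: sqr_ge0.
Qed.

End gaussian_second_moment.

(** * Pythagorean identity for the regression on a noisy observation *)

Section gaussian_orthogonality.
Context {d : measure_display} {T : measurableType d} {R : realType}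
  {P : probability T R}.
Implicit Types (X Y : {RV P >-> R}).

Lemma independent_RV_sym X Y : independent_RV X Y -> independent_RV Y X.
Proof. by move=> XY A B mA mB; rewrite setIC XY// muleC. Qed.

Lemma ge0_expectationD (f g : T -> R) :
    measurable_fun setT f -> measurable_fun setT g ->
    (forall t, 0 <= f t) -> (forall t, 0 <= g t) ->
  ('E_P[fun t => (f t + g t)%R] = 'E_P[f] + 'E_P[g])%E.
Proof.
move=> mf mg f0 g0; rewrite unlock -ge0_integralD//.
- by move=> t _; rewrite lee_fin.
- exact/measurable_EFinP.
- by move=> t _; rewrite lee_fin.
- exact/measurable_EFinP.
Qed.

Lemma ge0_expectationZl (k : R) (f : T -> R) :
    0 <= k -> measurable_fun setT f -> (forall t, 0 <= f t) ->
  ('E_P[fun t => (k * f t)%R] = k%:E * 'E_P[f])%E.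
Proof.
move=> k0 mf f0; rewrite unlock -ge0_integralZl//.
- exact/measurable_EFinP.
- by move=> t _; rewrite lee_fin.
Qed.

Lemma ge0_expectation_le (f g : T -> R) :
    measurable_fun setT f -> measurable_fun setT g ->
    (forall t, 0 <= f t) -> (forall t, f t <= g t) ->
  ('E_P[f] <= 'E_P[g])%E.
Proof.
move=> mf mg f0 fg; apply: (expectation_le mf mg f0) => [t|]; last exact: aeW.
exact: le_trans (f0 t) (fg t).
Qed.

(** Split k X - g(Z) as k (X - K Z) plus k K Z - g(Z). The reflection flips the first summand and
    keeps the second, so in the average the cross term cancels pointwise, before any integration. *)
Lemma gaussian_orthogonal X Y (vx vy A K k : R) (g : R -> R) :
    0 < vx -> 0 < vy -> K * (A ^+ 2 * vx + vy) = A * vx ->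
    centered_gaussian X vx -> centered_gaussian Y vy -> independent_RV X Y ->
    measurable_fun setT g ->
  ('E_P[fun t => ((k * X t - g (A * X t + Y t)) ^+ 2)%R] =
   'E_P[fun t => ((k * (X t - K * (A * X t + Y t))) ^+ 2)%R] +
   'E_P[fun t => ((k * K * (A * X t + Y t) - g (A * X t + Y t)) ^+ 2)%R])%E.
Proof.
move=> vx0 vy0 KE XN YN XY mg.
have mX : measurable_fun setT X by exact: measurable_funPT.
have mZ : measurable_fun setT (fun t => A * X t + Y t).
  by apply: measurable_funD; [exact: measurable_funM|exact: measurable_funPT].
have mgZ : measurable_fun setT (fun t => g (A * X t + Y t)).
  exact: (measurableT_comp mg mZ).
pose h (z : R * R) := (k * z.1 - g z.2) ^+ 2 / 2.
have mh : measurable_fun setT h.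
  apply: measurable_funM => //; apply: measurable_funX; apply: measurable_funB.
    exact: measurable_funM.
  exact: (measurableT_comp mg measurable_snd).
have h0 z : 0 <= h z by rewrite divr_ge0 ?sqr_ge0.
have mh1 : measurable_fun setT (fun t => h (X t, A * X t + Y t)).
  exact: (measurableT_comp mh (measurable_fun_pair mX mZ)).
have mh2 : measurable_fun setT
    (fun t => h (2 * K * (A * X t + Y t) - X t, A * X t + Y t)).
  apply: (measurableT_comp mh (measurable_fun_pair _ mZ)).
  by apply: measurable_funB => //; exact: measurable_funM.
transitivity ('E_P[fun t => h (X t, A * X t + Y t)%R] +
    'E_P[fun t => h (X t, A * X t + Y t)%R])%E.
  rewrite -ge0_expectationD//; congr ('E_P[_])%E; apply/funext => t.
  by rewrite /h/=; field.
(* Only the second of the two half-squares is reflected. *)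
rewrite {2}(gaussian_reflection vx0 vy0 KE XN YN XY mh h0) -ge0_expectationD//.
rewrite -ge0_expectationD.
- by congr ('E_P[_])%E; apply/funext => t; rewrite /h/=; field.
- apply: measurable_funX; apply: measurable_funM => //.
  by apply: measurable_funB => //; exact: measurable_funM.
- by apply: measurable_funX; apply: measurable_funB => //; exact: measurable_funM.
- by move=> t; exact: sqr_ge0.
- by move=> t; exact: sqr_ge0.
Qed.

(** The case A = K = 0, where Z = Y. *)
Lemma gaussian_orthogonal_indep X Y (vx vy k : R) (g : R -> R) :
    0 < vx -> 0 < vy ->
    centered_gaussian X vx -> centered_gaussian Y vy -> independent_RV X Y ->
    measurable_fun setT g ->
  ('E_P[fun t => ((k * X t - g (Y t)) ^+ 2)%R] =
   (k ^+ 2 * vx)%:E + 'E_P[fun t => (g (Y t) ^+ 2)%R])%E.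
Proof.
move=> vx0 vy0 XN YN XY mg.
have := @gaussian_orthogonal X Y vx vy 0 0 k g vx0 vy0.
rewrite !mul0r => /(_ erefl XN YN XY mg).
have -> : (fun t => (k * X t - g (0 * X t + Y t)) ^+ 2) =
    (fun t => (k * X t - g (Y t)) ^+ 2).
  by apply/funext => t; rewrite mul0r add0r.
have -> : (fun t => (k * 0 * (0 * X t + Y t) - g (0 * X t + Y t)) ^+ 2) =
    (fun t => g (Y t) ^+ 2).
  by apply/funext => t; rewrite mulr0 !mul0r !add0r sqrrN.
have -> : (fun t => (k * (X t - 0 * (0 * X t + Y t))) ^+ 2) =
    (fun t => k ^+ 2 * X t ^+ 2).
  by apply/funext => t; rewrite mul0r subr0 exprMn.
move=> ->; congr (_ + _)%E.
rewrite ge0_expectationZl ?sqr_ge0//.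
- by rewrite (gaussian_second_moment vx0 XN).
- by apply: measurable_funX; exact: measurable_funPT.
- by move=> t; exact: sqr_ge0.
Qed.

(** The independent case applied twice: it splits off X, then Y, the remaining constant being viewed
    as a function of X. *)
Lemma gaussian_affine_second_moment X Y (vx vy a c e : R) :
    0 < vx -> 0 < vy ->
    centered_gaussian X vx -> centered_gaussian Y vy -> independent_RV X Y ->
  ('E_P[fun t => ((a * X t + c * Y t + e) ^+ 2)%R] =
   (a ^+ 2 * vx + c ^+ 2 * vy + e ^+ 2)%:E)%E.
Proof.
move=> vx0 vy0 XN YN XY.
pose g y := - c * y - e; pose g' (x : R) := - e.
have mg : measurable_fun setT g.
  by apply: measurable_funB => //; exact: measurable_funM.
have mg' : measurable_fun setT g' by exact: measurable_cst.
have -> : (fun t => (a * X t + c * Y t + e) ^+ 2) =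
    (fun t => (a * X t - g (Y t)) ^+ 2).
  by apply/funext => t; rewrite /g; congr (_ ^+ 2); ring.
rewrite (gaussian_orthogonal_indep a vx0 vy0 XN YN XY mg).
have -> : (fun t => g (Y t) ^+ 2) = (fun t => (c * Y t - g' (X t)) ^+ 2).
  by apply/funext => t; rewrite /g /g' -sqrrN; congr (_ ^+ 2); ring.
rewrite (gaussian_orthogonal_indep c vy0 vx0 YN XN (independent_RV_sym XY) mg').
have -> : (fun t => g' (X t) ^+ 2) = cst (e ^+ 2).
  by apply/funext => t; rewrite /g' sqrrN.
by rewrite expectation_cst -!EFinD addrA.
Qed.

End gaussian_orthogonality.

Lemma sqr_sqrt_divK {R : rcfType} (p v : R) : 0 <= p -> 0 < v ->
  Num.sqrt (p / v) ^+ 2 * v = p.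
Proof.
by move=> p0 v0; rewrite sqr_sqrtr ?divfK ?gt_eqF// divr_ge0// ltW.
Qed.

(** * Affine maps as policies *)

Section affine_policies.
Context {R : realType}.

Let affine_fun (A C : R) : R -> R := fun z => A * z + C.

Let measurable_affine_fun A C : measurable_fun setT (affine_fun A C).
Proof. by apply: measurable_funD => //; exact: measurable_funM. Qed.

HB.instance Definition _ A C :=
  isMeasurableFun.Build _ _ _ _ _ (measurable_affine_fun A C).

Definition affine (A C : R) : policy R := affine_fun A C.

Lemma affineE A C z : affine A C z = A * z + C.
Proof. by []. Qed.

Lemma affine_linear A : linear_policy (affine A 0).
Proof. by exists A => z; rewrite affineE addr0. Qed.

Lemma affine_affine A C : affine_policy (affine A C).
Proof. by exists A, C. Qed.

End affine_policies.

(** The regression coefficient of m on A m + w. *)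
Definition mmse_gain {R : realType} (vm vw A : R) : R :=
  A * vm / (A ^+ 2 * vm + vw).

(** * Costs of affine policies *)

Section gaussian_costs.
Context {d : measure_display} {T : measurableType d} {R : realType}
  {P : probability T R} {m w : {RV P >-> R}} (b : R) {lambda vm vw : R}.
Hypotheses (vm_gt0 : 0 < vm) (vw_gt0 : 0 < vw) (lambda_gt0 : 0 < lambda)
  (m_gauss : centered_gaussian m vm) (w_gauss : centered_gaussian w vw)
  (mw_indep : independent_RV m w).
Implicit Types (ge gd : policy R) (A C K L : R).

Local Notation gain := (mmse_gain vm vw).

Let wm_indep := independent_RV_sym mw_indep.

Let measurable_policy ge (X : {RV P >-> R}) : measurable_fun setT (fun t => ge (X t)).
Proof. exact: (measurableT_comp (measurable_funPT ge) (measurable_funPT X)). Qed.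

(** Since K w is centered and independent of the rest of the error, the noise costs K^2 E[w^2]
    whatever the encoder does. What remains can be minimized separately for each value of m. *)
Lemma enc_cost_affine_decoder ge gd K L : (forall y, gd y = K * y + L) ->
  enc_cost m w b lambda ge gd = ((K ^+ 2 * vw)%:E +
    'E_P[fun t => ((m t - (K * ge (m t) + L) - b) ^+ 2 +
                   lambda * ge (m t) ^+ 2)%R])%E.
Proof.
move=> gdE; rewrite /enc_cost.
pose g z := z - (K * ge z + L) - b.
have mge : measurable_fun setT ge by exact: measurable_funPT.
have mg : measurable_fun setT g.
  apply: measurable_funB => //; apply: measurable_funB => //.
  by apply: measurable_funD => //; exact: measurable_funM.
have mgm : measurable_fun setT (fun t => g (m t) ^+ 2).
  by apply: measurable_funX; exact: (measurableT_comp mg (measurable_funPT m)).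
have mx : measurable_fun setT (fun t => lambda * ge (m t) ^+ 2).
  by apply: measurable_funM => //; apply: measurable_funX; exact: measurable_policy.
have x0 t : 0 <= lambda * ge (m t) ^+ 2 by rewrite mulr_ge0 ?sqr_ge0// ltW.
rewrite (ge0_expectationD mgm mx (fun=> sqr_ge0 _) x0) addeA.
(* Here w is the variable split off and m the one observed. *)
rewrite -(gaussian_orthogonal_indep K vw_gt0 vm_gt0 w_gauss m_gauss wm_indep mg).
rewrite -ge0_expectationD//.
- congr ('E_P[_])%E; apply/funext => t; rewrite /action gdE /g; ring.
- apply: measurable_funX; apply: measurable_funB.
    by apply: measurable_funM => //; exact: measurable_funPT.
  exact: (measurableT_comp mg (measurable_funPT m)).
- by move=> t; exact: sqr_ge0.
Qed.

Lemma dec_cost_affine ge gd A C K L :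
    (forall z, ge z = A * z + C) -> (forall y, gd y = K * y + L) ->
  dec_cost m w ge gd =
  ((1 - K * A) ^+ 2 * vm + K ^+ 2 * vw + (K * C + L) ^+ 2)%:E.
Proof.
move=> geE gdE; rewrite /dec_cost.
have -> : (fun t => (m t - action m w ge gd t) ^+ 2) =
    (fun t => ((1 - K * A) * m t + (- K) * w t + - (K * C + L)) ^+ 2).
  by apply/funext => t; rewrite /action geE gdE; congr (_ ^+ 2); ring.
rewrite (gaussian_affine_second_moment _ _ _ vm_gt0 vw_gt0 m_gauss w_gauss mw_indep).
by rewrite !sqrrN.
Qed.

Lemma enc_cost_affine ge gd A C K L :
    (forall z, ge z = A * z + C) -> (forall y, gd y = K * y + L) ->
  enc_cost m w b lambda ge gd =
  ((1 - K * A) ^+ 2 * vm + K ^+ 2 * vw + (K * C + L + b) ^+ 2 +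
   lambda * (A ^+ 2 * vm + C ^+ 2))%:E.
Proof.
move=> geE gdE; rewrite (enc_cost_affine_decoder _ gdE).
have -> : (fun t => (m t - (K * ge (m t) + L) - b) ^+ 2 + lambda * ge (m t) ^+ 2) =
   (fun t => ((1 - K * A) * m t + 0 * w t + - (K * C + L + b)) ^+ 2 +
             lambda * (A * m t + 0 * w t + C) ^+ 2).
  by apply/funext => t; rewrite geE; ring.
have mm : measurable_fun setT m by exact: measurable_funPT.
have mw : measurable_fun setT w by exact: measurable_funPT.
have maff a c e : measurable_fun setT (fun t => (a * m t + c * w t + e) ^+ 2).
  apply: measurable_funX; apply: measurable_funD => //.
  by apply: measurable_funD; exact: measurable_funM.
rewrite ge0_expectationD//; last 3 first.
- exact: measurable_funM.
- by move=> t; exact: sqr_ge0.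
- by move=> t; rewrite mulr_ge0 ?sqr_ge0// ltW.
rewrite ge0_expectationZl// ?ltW//; last by move=> t; exact: sqr_ge0.
rewrite !(gaussian_affine_second_moment _ _ _ vm_gt0 vw_gt0 m_gauss w_gauss mw_indep).
by rewrite -EFinM -!EFinD; congr EFin; ring.
Qed.

(** * The regression decoder and achievability *)

Let den_gt0 A : 0 < A ^+ 2 * vm + vw.
Proof. by rewrite ltr_wpDl// mulr_ge0 ?sqr_ge0// ltW. Qed.

(** A linear encoder followed by the regression decoder meets the information theoretic distortion
    at its own power. *)
Lemma mmse_error A : (1 - gain A * A) ^+ 2 * vm + gain A ^+ 2 * vw =
  dec_rhs vm vw (A ^+ 2 * vm).
Proof.
have Av := den_gt0 A; have vA : 0 < vw + A ^+ 2 * vm by rewrite addrC.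
by rewrite /mmse_gain /dec_rhs; field; rewrite !gt_eqF.
Qed.

(** By the Pythagorean identity with k = 1, any other decoder adds a nonnegative term to the
    regression error. *)
Lemma mmse_gain_optimal A gd :
  (dec_cost m w (affine A 0) (affine (gain A) 0) <=
   dec_cost m w (affine A 0) gd)%E.
Proof.
have KE : gain A * (A ^+ 2 * vm + vw) = A * vm by rewrite divfK// gt_eqF.
have := gaussian_orthogonal 1 vm_gt0 vw_gt0 KE m_gauss w_gauss mw_indep
  (measurable_funPT gd).
have -> : (fun t => (1 * m t - gd (A * m t + w t)) ^+ 2) =
    (fun t => (m t - action m w (affine A 0) gd t) ^+ 2).
  by apply/funext => t; rewrite /action affineE mul1r addr0.
have -> : (fun t => (1 * (m t - gain A * (A * m t + w t))) ^+ 2) =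
    (fun t => (m t - action m w (affine A 0) (affine (gain A) 0) t) ^+ 2).
  by apply/funext => t; rewrite /action !affineE mul1r !addr0.
rewrite /dec_cost => ->; apply: leeDl.
by apply: expectation_ge0 => t; exact: sqr_ge0.
Qed.

(* The two equations are the encoder's first-order condition at x = A m. *)
Lemma linear_nash A :
    A * (gain A ^+ 2 + lambda) = gain A -> gain A * b = 0 ->
  nash m w b lambda (affine A 0) (affine (gain A) 0).
Proof.
set K := gain A => foc Kb; split=> [ge|gd]; last exact: mmse_gain_optimal.
rewrite !(enc_cost_affine_decoder _ (affineE K 0)); apply: leeD => //.
have mcost (g : policy R) : measurable_fun setT
    (fun t => (m t - (K * g (m t) + 0) - b) ^+ 2 + lambda * g (m t) ^+ 2).
  have mm : measurable_fun setT m by exact: measurable_funPT.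
  have mgm := measurable_policy g m.
  apply: measurable_funD.
    apply: measurable_funX; apply: measurable_funB => //.
    apply: measurable_funB => //; apply: measurable_funD => //.
    exact: measurable_funM.
  by apply: measurable_funM => //; exact: measurable_funX.
apply: ge0_expectation_le; [exact: mcost|exact: mcost| |] => t.
  by rewrite addr_ge0 ?sqr_ge0// mulr_ge0 ?sqr_ge0// ltW.
rewrite affineE addr0 !addr0; move: (m t) (ge (m t)) => z x.
(* Exact expansion of the pointwise cost around x = A z; the two equations annihilate its linear
   term. *)
rewrite -subr_ge0 (_ : _ - _ = (K ^+ 2 + lambda) * (x - A * z) ^+ 2 +
   2 * (x - A * z) * (z * (A * (K ^+ 2 + lambda) - K) + K * b)); last by ring.
rewrite foc subrr Kb mulr0 addr0 mulr0 addr0.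
by rewrite mulr_ge0 ?sqr_ge0// addr_ge0 ?sqr_ge0// ltW.
Qed.

Lemma linear_game_achievable A :
    A * (gain A ^+ 2 + lambda) = gain A -> gain A * b = 0 ->
    A ^+ 2 * vm = game_power b lambda vm vw ->
  game_achievable m w b lambda vm vw linear_policy.
Proof.
move=> foc Kb Ap; pose K := gain A; exists (affine A 0), (affine K 0).
split; [exact: affine_linear|exact: affine_linear|exact: linear_nash|].
have encE : enc_cost m w b lambda (affine A 0) (affine K 0) =
    (enc_lb b lambda vm vw)%:E.
  rewrite (enc_cost_affine (affineE A 0) (affineE K 0)) /K mmse_error -/K.
  by rewrite /enc_lb -Ap /enc_rhs /dec_rhs; congr EFin; ring.
have decE : dec_cost m w (affine A 0) (affine K 0) = (dec_lb b lambda vm vw)%:E.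
  rewrite (dec_cost_affine (affineE A 0) (affineE K 0)) /K mmse_error -/K.
  by rewrite /dec_lb -Ap; congr EFin; ring.
by split=> //; rewrite /total_cost encE decE -EFinD.
Qed.

Lemma affine_team_achievable : team_achievable m w b lambda vm vw affine_policy.
Proof.
set p := argmin_ge0 (team_rhs b lambda vm vw).
(* A minimizer and the default value 0 are both nonnegative. *)
have p0 : 0 <= p by rewrite /p /argmin_ge0; case: xgetP => // q _ [].
pose A := Num.sqrt (p / vm); pose K := gain A.
have Ap : A ^+ 2 * vm = p by exact: sqr_sqrt_divK.
(* The offset -b/2 shares the bias equally: each agent pays b^2 / 4, for a total of b^2 / 2. *)
exists (affine A 0), (affine K (- (b / 2))).
split; [exact: affine_affine|exact: affine_affine|].
rewrite /total_cost (enc_cost_affine (affineE _ _) (affineE _ _)).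
rewrite (dec_cost_affine (affineE _ _) (affineE _ _)) /K mmse_error -EFinD.
rewrite /team_lb -/p -Ap /team_rhs /dec_rhs; congr EFin.
have -> : 2 * vm / (1 + A ^+ 2 * vm / vw) = 2 * (vm / (1 + A ^+ 2 * vm / vw)).
  by rewrite mulrA.
by move: (vm / _) => e; field.
Qed.

(** * The game in the informative regime *)

Lemma game_power_gt0 : lambda < vm / vw -> 0 < game_power b lambda vm vw.
Proof.
move=> lv; rewrite /game_power [argmin_ge0 _]argmin_ge0_lt//.
rewrite subr_gt0 ltr_pdivlMr// -ltr_sqr ?nnegrE ?sqrtr_ge0 ?mulr_ge0 ?ltW//.
have -> : (vw * lambda) ^+ 2 = lambda * vw * (lambda * vw) by ring.
rewrite sqr_sqrtr ?mulr_ge0 ?ltW//.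
by rewrite [ltRHS]mulrAC ltr_pM2l ?mulr_gt0// -ltr_pdivlMr.
Qed.

Lemma affine_game_not_achievable : lambda < vm / vw -> b != 0 ->
  ~ game_achievable m w b lambda vm vw affine_policy.
Proof.
move=> lv b0 [ge] [gd] [[A [C geE]] [K [L gdE]] [enc_opt dec_opt] [encE decE _]].
have p0 := game_power_gt0 lv; set p := game_power _ _ _ _ in p0.
(* The deviation is the regression of m on y - C; comparing with it forces K to be the regression
   gain and K C + L = 0. *)
have := dec_opt (affine (gain A) (- (gain A * C))).
rewrite (dec_cost_affine geE gdE) (dec_cost_affine geE (affineE _ _)) lee_fin.
rewrite subrr expr0n/= addr0.
rewrite -subr_ge0 (_ : _ - _ = - ((K - gain A) ^+ 2 * (A ^+ 2 * vm + vw) +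
  (K * C + L) ^+ 2)); last first.
  by rewrite /mmse_gain; field; rewrite gt_eqF.
rewrite oppr_ge0 => le0.
have /eqP : (K - gain A) ^+ 2 * (A ^+ 2 * vm + vw) + (K * C + L) ^+ 2 = 0.
  apply/eqP; rewrite eq_le le0 addr_ge0 ?sqr_ge0// mulr_ge0 ?sqr_ge0//.
  exact: ltW.
rewrite paddr_eq0 ?sqr_ge0 ?(mulr_ge0 _ (ltW (den_gt0 _))) ?sqr_ge0//.
rewrite mulf_eq0 (gt_eqF (den_gt0 A)) orbF !sqrf_eq0 subr_eq0.
move=> /andP[/eqP KA /eqP KCL].
move: decE; rewrite (dec_cost_affine geE gdE) KCL KA mmse_error expr0n/= addr0.
rewrite /dec_lb -/p => -[] decE.
(* The distortion is injective in the power, so the decoder cost determines A^2 E[m^2]. *)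
have Ap : A ^+ 2 * vm = p.
  have : (1 + A ^+ 2 * vm / vw)^-1 = (1 + p / vw)^-1.
    by apply: (mulfI (lt0r_neq0 vm_gt0)).
  by move/invr_inj/addrI/(mulIf (invr_neq0 (lt0r_neq0 vw_gt0))).
move: encE; rewrite (enc_cost_affine geE gdE) KCL KA mmse_error Ap.
rewrite /enc_lb -/p /enc_rhs /dec_rhs add0r => -[] encE.
(* The encoder's actual power is p + C^2, and the bound leaves no room for the extra lambda C^2. *)
have C0 : C = 0.
  have : lambda * C ^+ 2 = 0 by lra.
  by move/eqP; rewrite mulf_eq0 (gt_eqF lambda_gt0) sqrf_eq0 => /eqP.
have L0 : L = 0 by move: KCL; rewrite C0 mulr0 add0r.
(* This offset minimizes (K c + b)^2 + lambda c^2 over c, and saves (K b)^2 / (K^2 + lambda)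
   compared with c = 0. *)
have := enc_opt (affine A (- (K * b) / (K ^+ 2 + lambda))).
rewrite (enc_cost_affine geE gdE) (enc_cost_affine (affineE _ _) gdE) lee_fin.
have k0 : 0 < K ^+ 2 + lambda by rewrite ltr_wpDl ?sqr_ge0.
rewrite -subr_ge0 C0 L0 (_ : _ - _ = - ((K * b) ^+ 2 / (K ^+ 2 + lambda))); last first.
  by field; rewrite gt_eqF.
rewrite oppr_ge0 pmulr_lle0 ?invr_gt0// => Kb.
have : (K * b) ^+ 2 == 0 by rewrite eq_le Kb sqr_ge0.
(* As b is nonzero, K = 0; then A = 0, against the positive power. *)
rewrite sqrf_eq0 mulf_eq0 (negbTE b0) orbF KA /mmse_gain !mulf_eq0 invr_eq0.
rewrite (gt_eqF vm_gt0) (gt_eqF (den_gt0 A)) !orbF => /eqP A0.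
by move: p0; rewrite -Ap A0 expr0n/= mul0r ltxx.
Qed.

End gaussian_costs.

(** * Choice of the encoder gain in each regime *)

Theorem mainTheorem7 (R : realType) (d : measure_display)
    (T : measurableType d) (P : probability T R) (m w : {RV P >-> R})
    (b lambda vm vw : R)
    (vm_gt0 : 0 < vm) (vw_gt0 : 0 < vw) (lambda_gt0 : 0 < lambda)
    (m_gauss : centered_gaussian m vm) (w_gauss : centered_gaussian w vw)
    (mw_indep : independent_RV m w) :
  [/\ vm / vw <= lambda ->
        game_achievable m w b lambda vm vw any_policy,
      lambda < vm / vw -> b = 0 ->
        game_achievable m w b lambda vm vw linear_policy,
      lambda < vm / vw -> b != 0 ->
        ~ game_achievable m w b lambda vm vw affine_policy &
      team_achievable m w b lambda vm vw affine_policy].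
Proof.
split=> [lv|lv b0|lv b0|].
(* The optimal power is 0, so both policies are taken to be zero. *)
- have : game_achievable m w b lambda vm vw linear_policy.
    apply: (linear_game_achievable vm_gt0 vw_gt0 lambda_gt0 m_gauss w_gauss
      mw_indep (A := 0)).
    + by rewrite /mmse_gain !mul0r.
    + by rewrite /mmse_gain !mul0r.
    + by rewrite expr0n/= mul0r /game_power [argmin_ge0 _]argmin_ge0_ge.
  by move=> [ge [gd [_ _ ? ?]]]; exists ge, gd.
- have p0 := game_power_gt0 b vm_gt0 vw_gt0 lambda_gt0 lv.
  set p := game_power _ _ _ _ in p0.
  have Ap : Num.sqrt (p / vm) ^+ 2 * vm = p by rewrite sqr_sqrt_divK// ltW.
  apply: (linear_game_achievable vm_gt0 vw_gt0 lambda_gt0 m_gauss w_gauss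
    mw_indep (A := Num.sqrt (p / vm))); [|by rewrite b0 mulr0|exact: Ap].
  rewrite /mmse_gain Ap.
  have pv : 0 < p + vw by exact: addr_gt0.
  (* Stationarity of the encoder bound at p; substituting it for lambda turns the encoder's
     first-order condition into an identity. *)
  have pE : lambda * (p + vw) ^+ 2 = vm * vw.
    rewrite /p /game_power [argmin_ge0 _]argmin_ge0_lt// subrK exprMn.
    rewrite sqr_sqrtr ?mulr_ge0 ?ltW//.
    by field; rewrite gt_eqF.
  set A := Num.sqrt _ in Ap *.
  have -> : (A * vm / (p + vw)) ^+ 2 = p * vm / (p + vw) ^+ 2.
    by rewrite -[X in X * vm / _]Ap; field; rewrite gt_eqF.
  have -> : lambda = vm * vw / (p + vw) ^+ 2.
    by rewrite -pE mulfK// expf_neq0// gt_eqF.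
  by field; rewrite gt_eqF.
- exact: affine_game_not_achievable.
- exact: affine_team_achievable.
Qed.
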